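(* Let $\mathbf{S}$ be a category with binary pullbacks and let $\mathbf{P}$ be a subcategory of $\mathbf{S}$ (of path objects). Let $p_a: P\to A$ and $s_a: S\to A$ be morphisms in $\mathbf{S}$ and assume that $p_a: P\to A$ is $\mathbf{P}$-faithful. Then there exists a bisimulation controller $c_a: C\to A$ for the plant $p_a: P\to A$ enforcing the specification $s_a: S\to A$ if and only if there exist an object $Z$ of $\mathbf{S}$ and morphisms $\gamma: Z\to S$ and $\delta: Z\to P$ in $\mathbf{S}$ with $s_a\circ\gamma=p_a\circ\delta$ and such that $\gamma$ is $\mathbf{P}$-open. Furthermore, when a bisimulation controller exists, one can take $C=S$ and $c_a=s_a$, i.e. $s_a: S\to A$ is itself a bisimulation controller for $p_a: P\to A$ enforcing $s_a: S\to A$.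
   Context: $\mathbf{S}$ is a category and $\mathbf{P}$ a subcategory of $\mathbf{S}$, whose objects are called path objects and whose morphisms describe how path objects can be extended. $\mathbf{P}$-open: a morphism $f: X\to Y$ in $\mathbf{S}$ is $\mathbf{P}$-open if for all path objects $C,D$, every morphism $e: C\to D$ of $\mathbf{P}$, and all morphisms $c: C\to X$ and $d: D\to Y$ in $\mathbf{S}$ with $f\circ c=d\circ e$, there exists a morphism $r: D\to X$ in $\mathbf{S}$ with $c=r\circ e$ and $d=f\circ r$. $\mathbf{P}$-faithful: a morphism $f: X\to Y$ in $\mathbf{S}$ is $\mathbf{P}$-faithful if for all path objects $C,D$, every morphism $e: C\to D$ of $\mathbf{P}$, and all morphisms $c: C\to X$ and $d: D\to Y$ in $\mathbf{S}$ with $f\circ c=d\circ e$, whenever $r,s: D\to X$ are morphisms in $\mathbf{S}$ with $c=r\circ e=s\circ e$ and $d=f\circ r=f\circ s$, then $r=s$. Binary pullbacks: $\mathbf{S}$ has binary pullbacks if the pullback $X\times_A Y$ of any two morphisms $X\to A$ and $Y\to A$ with common codomain exists in $\mathbf{S}$. Bisimulation controller: given morphisms $p_a: P\to A$, $s_a: S\to A$, $c_a: C\to A$ in $\mathbf{S}$, let $C\times_A P$ be the pullback of $c_a$ and $p_a$, and let $cp_a: C\times_A P\to A$ be the canonical morphism (the composite of the projection $C\times_A P\to P$ with $p_a$, equivalently of the projection $C\times_A P\to C$ with $c_a$). The morphism $c_a: C\to A$ is a bisimulation controller for the plant $p_a: P\to A$ enforcing the specification $s_a: S\to A$ if there exist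 an object $Z$ and $\mathbf{P}$-open morphisms $s: Z\to S$ and $cp: Z\to C\times_A P$ in $\mathbf{S}$ such that $s_a\circ s=cp_a\circ cp$. *)

(* Defs.v *)
Set Implicit Arguments.
Unset Strict Implicit.
Unset Printing Implicit Defensive.

Declare Scope cat_scope.
Delimit Scope cat_scope with cat.
Local Open Scope cat_scope.

Record category : Type := Category {
  obj :> Type;
  hom : obj -> obj -> Type;
  idm : forall X : obj, hom X X;
  comp : forall X Y Z : obj, hom Y Z -> hom X Y -> hom X Z;
  comp_idl : forall (X Y : obj) (f : hom X Y), comp (idm Y) f = f;
  comp_idr : forall (X Y : obj) (f : hom X Y), comp f (idm X) = f;
  comp_assoc : forall (W X Y Z : obj) (h : hom Y Z) (g : hom X Y) (f : hom W X),
    comp h (comp g f) = comp (comp h g) f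
}.

Arguments hom {c} X Y.
Arguments idm {c} X.
Arguments comp {c X Y Z} g f : rename.

Notation "X ~> Y" := (hom X Y) (at level 55, no associativity) : cat_scope.
Notation "g \o f" := (comp g f) (at level 50, left associativity) : cat_scope.

(* Not required to be full. *)
Record subcategory (S : category) : Type := Subcategory {
  sub_obj : S -> Prop;
  sub_hom : forall X Y : S, X ~> Y -> Prop;
  sub_dom : forall (X Y : S) (f : X ~> Y), sub_hom f -> sub_obj X;
  sub_cod : forall (X Y : S) (f : X ~> Y), sub_hom f -> sub_obj Y;
  sub_idm : forall X : S, sub_obj X -> sub_hom (idm X);
  sub_comp : forall (X Y Z : S) (g : Y ~> Z) (f : X ~> Y),
    sub_hom g -> sub_hom f -> sub_hom (g \o f)
}.

Definition P_open (S : category) (P : subcategory S) (X Y : S) (f : X ~> Y) : Prop :=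
  forall C D : S, sub_obj P C -> sub_obj P D ->
  forall e : C ~> D, sub_hom P e ->
  forall (c : C ~> X) (d : D ~> Y), f \o c = d \o e ->
  exists r : D ~> X, c = r \o e /\ d = f \o r.

Definition P_faithful (S : category) (P : subcategory S) (X Y : S) (f : X ~> Y) : Prop :=
  forall C D : S, sub_obj P C -> sub_obj P D ->
  forall e : C ~> D, sub_hom P e ->
  forall (c : C ~> X) (d : D ~> Y), f \o c = d \o e ->
  forall r s : D ~> X,
    c = r \o e -> c = s \o e -> d = f \o r -> d = f \o s -> r = s.

Record pullback (S : category) (X Y A : S) (f : X ~> A) (g : Y ~> A) : Type := Pullback {
  pb_obj :> S;
  pb_fst : pb_obj ~> X;
  pb_snd : pb_obj ~> Y;
  pb_comm : f \o pb_fst = g \o pb_snd;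
  pb_univ : forall (W : S) (h : W ~> X) (k : W ~> Y), f \o h = g \o k ->
    exists! u : W ~> pb_obj, pb_fst \o u = h /\ pb_snd \o u = k
}.

Definition has_binary_pullbacks (S : category) : Prop :=
  forall (X Y A : S) (f : X ~> A) (g : Y ~> A), inhabited (pullback f g).

Definition pb_diag (S : category) (X Y A : S) (f : X ~> A) (g : Y ~> A)
    (W : pullback f g) : W ~> A := g \o pb_snd W.

Definition bisim_controller_at (S : category) (P : subcategory S) (Pl Sp A C : S)
    (p_a : Pl ~> A) (s_a : Sp ~> A) (c_a : C ~> A) (CP : pullback c_a p_a) : Prop :=
  exists (Z : S) (s : Z ~> Sp) (cp : Z ~> CP),
    P_open P s /\ P_open P cp /\ s_a \o s = pb_diag CP \o cp.

(* Pullbacks are only determined up to isomorphism; by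
   [bisim_controllerP] below the choice of [CP] is immaterial. *)
Definition bisim_controller (S : category) (P : subcategory S) (Pl Sp A C : S)
    (p_a : Pl ~> A) (s_a : Sp ~> A) (c_a : C ~> A) : Prop :=
  exists CP : pullback c_a p_a, bisim_controller_at P s_a CP.

Lemma pb_unique (S : category) (X Y A : S) (f : X ~> A) (g : Y ~> A)
    (V : pullback f g) (W : S) (u v : W ~> V) :
  pb_fst V \o u = pb_fst V \o v -> pb_snd V \o u = pb_snd V \o v -> u = v.
Proof.
intros H1 H2.
assert (E : f \o (pb_fst V \o v) = g \o (pb_snd V \o v)).
{ now rewrite !comp_assoc, pb_comm. }
destruct (pb_univ V E) as [w [_ Hw]].
rewrite <- (Hw u); [apply Hw|]; auto.
Qed.

Lemma bisim_controllerP (S : category) (P : subcategory S) (Pl Sp A C : S)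
    (p_a : Pl ~> A) (s_a : Sp ~> A) (c_a : C ~> A) (CP : pullback c_a p_a) :
  bisim_controller P p_a s_a c_a <-> bisim_controller_at P s_a CP.
Proof.
split; [|now exists CP].
intros [CP' [Z [s [cp [Hs [Hcp Hc]]]]]].
destruct (pb_univ CP (pb_comm CP')) as [i [[i1 i2] _]].
destruct (pb_univ CP' (pb_comm CP)) as [j [[j1 j2] _]].
assert (ij : i \o j = idm _).
{ apply pb_unique; rewrite comp_assoc, comp_idr.
  - now rewrite i1, j1.
  - now rewrite i2, j2. }
assert (ji : j \o i = idm _).
{ apply pb_unique; rewrite comp_assoc, comp_idr.
  - now rewrite j1, i1.
  - now rewrite j2, i2. }
exists Z, s, (i \o cp); split; [exact Hs|split].
- intros X Y HX HY e He c d E.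
  assert (E' : cp \o c = (j \o d) \o e).
  { now rewrite <- comp_assoc, <- E, !comp_assoc, ji, comp_idl. }
  destruct (Hcp X Y HX HY e He c (j \o d) E') as [r [R1 R2]].
  exists r; split; [exact R1|].
  now rewrite <- comp_assoc, <- R2, comp_assoc, ij, comp_idl.
- rewrite Hc; unfold pb_diag.
  now rewrite <- !comp_assoc, (comp_assoc (pb_snd CP) i), i2.
Qed.

(* Main.v *)
Require Import Defs.
Local Open Scope cat_scope.

(** A controller gives a pair [(gamma, delta)] by composing the open morphism
    into the pullback of [c_a] and [p_a] with the projection to the plant.
    Conversely, a pair [(gamma, delta)] with [s_a \o gamma = p_a \o delta] is
    the same as one morphism [u] from [Z] into the pullback of [s_a] and
    [p_a], and [gamma] is [u] followed by the projection to [Sp].  So with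
    [s_a] as controller it remains to see that [u] inherits openness from
    [gamma].  Faithfulness of [p_a] is what makes this work: it passes to the
    projection along the pullback ([P_faithful_pb_fst]), and an open composite
    whose last factor is faithful has an open first factor
    ([P_open_cancel_faithful]).  The converse direction thus always produces
    the controller [s_a], which also yields the final claim. *)

(** Two lifts through the projection already agree on the first component, and
    their second components are lifts of one square through [g], so that
    faithfulness of [g] identifies them. *)
Lemma P_faithful_pb_fst (S : category) (P : subcategory S) (X Y A : S)
    (f : X ~> A) (g : Y ~> A) (W : pullback f g) :
  P_faithful P g -> P_faithful P (pb_fst W).
Proof.
intros Hg C D HC HD e He c d E r s Hr Hs Dr Ds.
apply pb_unique; [congruence|].
apply (Hg C D HC HD e He (pb_snd W \o c) (f \o d)).
- now rewrite comp_assoc, <- pb_comm, <- !comp_assoc, E.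
- now rewrite Hr, comp_assoc.
- now rewrite Hs, comp_assoc.
- now rewrite Dr, !comp_assoc, pb_comm.
- now rewrite Ds, !comp_assoc, pb_comm.
Qed.

(** Openness of the composite lifts [p \o d] to some [r]; then [u \o r] and [d]
    are both lifts of one square through [p], hence equal. *)
Lemma P_open_cancel_faithful (S : category) (P : subcategory S) (X Y Z : S)
    (p : Y ~> Z) (u : X ~> Y) :
  P_faithful P p -> P_open P (p \o u) -> P_open P u.
Proof.
intros Hp Ho C D HC HD e He c d E.
assert (E' : p \o u \o c = p \o d \o e).
{ now rewrite <- !comp_assoc, E. }
destruct (Ho C D HC HD e He c (p \o d) E') as [r [Hc Hd]].
exists r; split; [exact Hc|].
apply (Hp C D HC HD e He (u \o c) (p \o d)).
- now rewrite comp_assoc.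
- exact E.
- now rewrite Hc, comp_assoc.
- reflexivity.
- now rewrite Hd, comp_assoc.
Qed.

Lemma bisim_controller_open_span (S : category) (P : subcategory S)
    (Pl Sp A C : S) (p_a : Pl ~> A) (s_a : Sp ~> A) (c_a : C ~> A) :
  bisim_controller P p_a s_a c_a ->
  exists (Z : S) (gamma : Z ~> Sp) (delta : Z ~> Pl),
    s_a \o gamma = p_a \o delta /\ P_open P gamma.
Proof.
intros [CP [Z [s [cp [Hs [_ E]]]]]].
exists Z, s, (pb_snd CP \o cp); split; [|exact Hs].
now rewrite E, comp_assoc.
Qed.

(** The specification as its own controller: the witness is the morphism from
    [Z] into the pullback of [s_a] and [p_a] induced by [gamma] and [delta]. *)
Lemma spec_bisim_controller (S : category) (P : subcategory S)
    (S_pullbacks : has_binary_pullbacks S)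
    (Pl Sp A Z : S) (p_a : Pl ~> A) (s_a : Sp ~> A)
    (gamma : Z ~> Sp) (delta : Z ~> Pl) :
  P_faithful P p_a -> s_a \o gamma = p_a \o delta -> P_open P gamma ->
  bisim_controller P p_a s_a s_a.
Proof.
intros Hp E Hgamma.
destruct (S_pullbacks _ _ _ s_a p_a) as [W].
destruct (pb_univ W E) as [u [[u1 u2] _]].
exists W, Z, gamma, u; split; [exact Hgamma|split].
- apply P_open_cancel_faithful with (p := pb_fst W).
  + now apply P_faithful_pb_fst.
  + now rewrite u1.
- unfold pb_diag; now rewrite <- comp_assoc, u2.
Qed.

Theorem theorem6p3 (S : category) (P : subcategory S)
    (S_pullbacks : has_binary_pullbacks S)
    (Pl Sp A : S) (p_a : Pl ~> A) (s_a : Sp ~> A)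
    (p_a_faithful : P_faithful P p_a) :
  ((exists (C : S) (c_a : C ~> A), bisim_controller P p_a s_a c_a) <->
   (exists (Z : S) (gamma : Z ~> Sp) (delta : Z ~> Pl),
      s_a \o gamma = p_a \o delta /\ P_open P gamma)) /\
  ((exists (C : S) (c_a : C ~> A), bisim_controller P p_a s_a c_a) ->
   bisim_controller P p_a s_a s_a).
Proof.
assert (Hspan : (exists (C : S) (c_a : C ~> A), bisim_controller P p_a s_a c_a) ->
  exists (Z : S) (gamma : Z ~> Sp) (delta : Z ~> Pl),
    s_a \o gamma = p_a \o delta /\ P_open P gamma).
{ intros [C [c_a Hc]]; exact (bisim_controller_open_span _ _ _ _ _ _ _ _ _ Hc). }
assert (Hspec : (exists (Z : S) (gamma : Z ~> Sp) (delta : Z ~> Pl),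
    s_a \o gamma = p_a \o delta /\ P_open P gamma) ->
  bisim_controller P p_a s_a s_a).
{ intros [Z [gamma [delta [E Hgamma]]]].
  exact (spec_bisim_controller _ _ S_pullbacks _ _ _ _ _ _ _ _
           p_a_faithful E Hgamma). }
split; [split|]; auto.
intros H; exists Sp, s_a; auto.
Qed.
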